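(* Let $\sigma$ be a 2-structure and let $X\subsetneq V(\sigma)$ be such that $\sigma[X]$ is prime; write $\overline{X}=V(\sigma)\setminus X$. Suppose that Statement (S5) holds (there is no $Y\subseteq\overline{X}$ with $|Y|=5$ such that $\sigma[X\cup Y]$ is prime) and that $\sigma$ is $\overline{X}$-critical. Then for each $x\in\overline{X}$ there exists $y\in\overline{X}\setminus\{x\}$ such that $\sigma-\{x,y\}$ is $(\overline{X}\setminus\{x,y\})$-critical.
   Context: A 2-structure $\sigma$ consists of a (finite or infinite) vertex set $V(\sigma)$ and an equivalence relation $\equiv_\sigma$ on ordered pairs of distinct vertices; $\sigma[W]$ is the induced 2-structure on $W$, $\sigma-W=\sigma[V(\sigma)\setminus W]$. A module is a set $M$ such that for all $x,y\in M$ and $v\notin M$, $(x,v)\equiv_\sigma(y,v)$ and $(v,x)\equiv_\sigma(v,y)$; $\emptyset$, $V(\sigma)$, singletons are trivial; $\sigma$ is prime if $|V(\sigma)|\geq3$ and all modules are trivial. For $W\subseteq V(\sigma)$, a 2-structure $\tau$ is $W$-critical if $\tau$ is prime and $\tau-w$ is not prime for every $w\in W$. *)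

(* Defs.v *)
From Stdlib Require Import Classical.

Set Implicit Arguments.

(* A 2-structure sigma is given by a carrier type T, a vertex set V : T -> Prop
   and a relation E on ordered pairs (of elements of T).  The condition
   [two_structure V E] says that E is an equivalence relation on the ordered
   pairs of distinct vertices of V.  Induced substructures sigma[W] (W a subset
   of V) use the same relation E restricted to pairs of distinct elements of W;
   thus sigma[W] is represented by the pair (W, E). *)

Definition vset (T : Type) := T -> Prop.

Definition dpair (T : Type) (V : vset T) (p : T * T) : Prop :=
  V (fst p) /\ V (snd p) /\ fst p <> snd p.

Definition two_structure (T : Type) (V : vset T) (E : T * T -> T * T -> Prop) : Prop :=
  (forall p, dpair V p -> E p p) /\
  (forall p q, dpair V p -> dpair V q -> E p q -> E q p) /\
  (forall p q r, dpair V p -> dpair V q -> dpair V r -> E p q -> E q r -> E p r).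

Definition subset (T : Type) (A B : vset T) : Prop := forall x, A x -> B x.
Definition setD (T : Type) (A B : vset T) : vset T := fun x => A x /\ ~ B x.
Definition setU (T : Type) (A B : vset T) : vset T := fun x => A x \/ B x.
Definition set1 (T : Type) (a : T) : vset T := fun x => x = a.
Definition set2 (T : Type) (a b : T) : vset T := fun x => x = a \/ x = b.

Definition is_module (T : Type) (E : T * T -> T * T -> Prop) (W M : vset T) : Prop :=
  subset M W /\
  forall x y v, M x -> M y -> W v -> ~ M v ->
    E (x, v) (y, v) /\ E (v, x) (v, y).

Definition trivial_module (T : Type) (W M : vset T) : Prop :=
  (forall x, ~ M x) \/ (forall x, M x <-> W x) \/ (exists a, forall x, M x <-> x = a).

Definition prime2 (T : Type) (E : T * T -> T * T -> Prop) (W : vset T) : Prop :=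
  (exists a b c, W a /\ W b /\ W c /\ a <> b /\ a <> c /\ b <> c) /\
  forall M, is_module E W M -> trivial_module W M.

Definition critical (T : Type) (E : T * T -> T * T -> Prop) (U Z : vset T) : Prop :=
  prime2 E U /\ forall z, Z z -> ~ prime2 E (setD U (set1 z)).

(* Main.v *)
(* Since S5 holds and sigma is critical outside X, no sigma[X u Y] with |Y| = 1 or
   |Y| = 3 is prime, because primality propagates upwards by adding pairs
   (Ehrenfeucht-Rozenberg).  Hence every outside vertex lies in a block X(u) or
   <X>, and the outside graph, whose edges are the pairs {a, b} with
   sigma[X u {a, b}] prime, controls primality: sigma[X u Y] is prime as soon as
   the graph on Y has neither isolated vertices nor twins inside a block, and
   the whole outside graph has this property.  Moreover the neighbours of a
   vertex all lie in one block.  A 5-vertex path would yield a prime extension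
   by 5 vertices, so the graph has no induced P5.  If x is removed, criticality
   makes some neighbour a of x isolated, or a twin of some b with
   N(a) = N(b) u {x}; in both cases the absence of P5 shows that removing x and a
   again leaves neither isolated vertices nor twins.  Finally, the remaining
   structure is critical: if another z could be removed, adding a pair back would
   contradict the criticality of sigma. *)
Require Import Defs.
From Stdlib Require Import Classical FunctionalExtensionality PropExtensionality.

Set Implicit Arguments.

Lemma vset_ext (T : Type) (A B : vset T) : (forall x, A x <-> B x) -> A = B.
Proof.
  intros H; apply functional_extensionality; intros x.
  now apply propositional_extensionality.
Qed.

Definition set3 (T : Type) (a b c : T) : vset T := fun x => x = a \/ x = b \/ x = c.

(** * Graphs with neither isolated vertices nor twins inside a class *)

Section ReducedGraph.
Context (T : Type) (Z : vset T) (adj same : T -> T -> Prop).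

(* Twins in distinct classes are harmless: they never form a module. *)
Definition reduced (Y : vset T) : Prop :=
  (forall y, Y y -> exists z, Y z /\ adj z y) /\
  (forall y y', Y y -> Y y' -> y <> y' -> same y y' ->
     exists z, Y z /\ (adj z y /\ ~ adj z y' \/ adj z y' /\ ~ adj z y)).

Hypothesis adj_sym : forall a b, adj a b -> adj b a.
Hypothesis adj_nsame : forall a b, Z a -> Z b -> adj a b -> ~ same a b.
Hypothesis same_sym : forall a b, same a b -> same b a.
Hypothesis common_same :
  forall z a b, Z z -> Z a -> Z b -> adj z a -> adj z b -> same a b.
Hypothesis no_P5 : forall a b c d e, Z a -> Z b -> Z c -> Z d -> Z e ->
  adj a b -> adj b c -> adj c d -> adj d e -> ~ adj a d -> ~ adj b e -> False.
Hypothesis reducedZ : reduced Z.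

Lemma reduced_remove_pair x :
  Z x -> ~ reduced (setD Z (set1 x)) ->
  exists a, Z a /\ a <> x /\ reduced (setD Z (set2 x a)).
Proof.
  intros Zx nR.
  destruct reducedZ as [iso twin].
  (* The damage done by removing [x] shows at [a]: either [x] was its only neighbour, or [x] alone
     told it apart from [b]. In both cases [a] is adjacent to [x]. *)
  assert (exists a, Z a /\ adj x a /\
    ((forall z, Z z -> adj z a -> z = x) \/
     exists b, Z b /\ same a b /\ a <> b /\ ~ adj x b /\
       forall z, Z z -> z <> x -> (adj z a <-> adj z b))) as (a & Za & xa & H).
  { apply NNPP; intros no; apply nR; split.
    - intros y [Zy yx]; apply NNPP; intros ny.
      assert (only : forall z, Z z -> adj z y -> z = x).
      { intros z Zz A; apply NNPP; intros zx; apply ny; now exists z. }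
      apply no; exists y; split; [easy|]; split; [|now left].
      destruct (iso y Zy) as (z & Zz & A); now rewrite <- (only z Zz A).
    - intros y y' [Zy yx] [Zy' yx'] ne S; apply NNPP; intros ny.
      assert (eqv : forall z, Z z -> z <> x -> (adj z y <-> adj z y')).
      { intros z Zz zx; apply NNPP; intros h; apply ny; exists z.
        split; [now split|]; tauto. }
      destruct (twin y y' Zy Zy' ne S) as (z & Zz & D).
      assert (z = x) as ->.
      { apply NNPP; intros zx; pose proof (eqv z Zz zx); tauto. }
      apply no; destruct D as [[A B] | [A B]].
      + exists y; split; [easy|]; split; [easy|]; right; now exists y'.
      + exists y'; split; [easy|]; split; [easy|]; right; exists y.
        split; [easy|]; split; [auto|]; split; [auto|]; split; [easy|].
        intros z Zz' zx; symmetry; auto. }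
  assert (ax : a <> x).
  { intros ->; apply (adj_nsame Zx Zx xa), (@common_same x x x); auto. }
  exists a; split; [easy|]; split; [easy|].
  (* All neighbours of an isolated [c] would be among [x] and [a]. If [x] is the only neighbour of
     [a], then [a] and [c] are twins. Otherwise [c], [x], [a], [z], [b] is a forbidden path, or [c]
     is adjacent to [a], hence also to [b], which is still present. *)
  assert (isoR : forall c, setD Z (set2 x a) c -> exists z, setD Z (set2 x a) z /\ adj z c).
  { intros c [Zc nc]; apply NNPP; intros no.
    assert (cx : c <> x) by (intros ->; apply nc; now left).
    assert (ca : c <> a) by (intros ->; apply nc; now right).
    assert (Nc : forall z, Z z -> adj z c -> z = x \/ z = a).
    { intros z Zz A; apply NNPP; intros h; apply no; exists z.
      split; [now split | easy]. }
    destruct H as [only | (b & Zb & S & ab & xb & eqv)].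
    - assert (nac : ~ adj a c) by (intros A; apply cx, only; auto).
      assert (xc : adj x c).
      { destruct (iso c Zc) as (w & Zw & A); destruct (Nc w Zw A); subst; easy. }
      destruct (twin a c Za Zc) as (z & Zz & [[A B] | [A B]]); auto.
      + now apply (common_same Zx).
      + rewrite (only z Zz A) in B; easy.
      + destruct (Nc z Zz A); subst; easy.
    - assert (bx : b <> x) by (intros ->; apply (adj_nsame Zx Za xa); auto).
      destruct (iso c Zc) as (w & Zw & A); destruct (Nc w Zw A); subst w.
      + destruct (iso b Zb) as (z & Zz & zb).
        assert (zx : z <> x) by congruence.
        assert (za : adj z a) by now apply eqv.
        apply (@no_P5 c x a z b); auto.
        intros cz; apply adj_sym in cz; destruct (Nc z Zz cz) as [-> | ->]; [easy|].
        now apply (adj_nsame Za Za za), (@common_same x a a).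
      + assert (bc : adj b c) by (apply adj_sym, eqv; auto).
        destruct (Nc b Zb bc); congruence. }
  split; [exact isoR|].
  (* A vertex [w] separating twins of the remaining graph is [x] or [a]. If it is [x], then [a] and
     [c] share a class, and a vertex [f] separating them closes one of the paths [c], [x], [a], [f],
     [b] and [a], [x], [c], [f], [d]. If it is [a], then [b], which is still present, separates [c]
     from [d] as well. *)
  assert (sep : forall c d w, setD Z (set2 x a) c -> setD Z (set2 x a) d ->
    (forall z, setD Z (set2 x a) z -> adj z c -> adj z d) ->
    (forall z, setD Z (set2 x a) z -> adj z d -> adj z c) ->
    Z w -> adj w c -> ~ adj w d -> False).
  { intros c d w Rc Rd cd dc Zw wc nwd.
    destruct (isoR c Rc) as (z & Rz & zc).
    pose proof (cd z Rz zc) as zd.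
    destruct Rc as [Zc nc], Rd as [Zd nd].
    assert (cx : c <> x) by (intros ->; apply nc; now left).
    assert (dx : d <> x) by (intros ->; apply nd; now left).
    assert (ca : c <> a) by (intros ->; apply nc; now right).
    assert (w = x \/ w = a) as [-> | ->].
    { apply NNPP; intros h; apply nwd, cd; [now split | easy]. }
    - assert (S : same a c) by now apply (common_same Zx).
      destruct (twin a c Za Zc) as (f & Zf & [[A B] | [A B]]); auto.
      + assert (fx : f <> x) by congruence.
        destruct H as [only | (b & Zb & _ & _ & xb & eqv)]; [now apply fx, only|].
        apply (@no_P5 c x a f b); auto; now apply eqv.
      + assert (Rf : setD Z (set2 x a) f).
        { split; [easy|]; intros [-> | ->]; [easy|].
          now apply (adj_nsame Za Zc A). }
        apply (@no_P5 a x c f d); auto.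
    - destruct H as [only | (b & Zb & S & ab & xb & eqv)]; [apply cx, only; auto|].
      assert (bc : adj b c) by (apply adj_sym, eqv; auto).
      assert (bd : adj b d).
      { apply cd; [|easy]; split; [easy|]; intros [-> | ->]; [|easy].
        apply (adj_nsame Zx Za xa); auto. }
      apply nwd, adj_sym, eqv; auto. }
  intros c d Rc Rd ne S; apply NNPP; intros no.
  assert (cd : forall z, setD Z (set2 x a) z -> adj z c -> adj z d).
  { intros z Rz A; apply NNPP; intros B; apply no; exists z; auto. }
  assert (dc : forall z, setD Z (set2 x a) z -> adj z d -> adj z c).
  { intros z Rz A; apply NNPP; intros B; apply no; exists z; auto. }
  destruct (twin c d) as (w & Zw & [[A B] | [A B]]); auto;
    [apply Rc | apply Rd | |].
  - now apply (sep c d w).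
  - now apply (sep d c w).
Qed.

End ReducedGraph.

(** * Modules and primality for colourings of ordered pairs *)

Section Coloring.
Context (T K : Type) (F : T -> T -> K) (sw : K -> K).
Hypothesis F_sw : forall a b, F b a = sw (F a b).

(** One orientation is enough: by [F_sw] the colour of a pair determines that of the reversed
    pair. *)
Definition fmodule (W M : vset T) : Prop :=
  subset M W /\
  forall x y v, M x -> M y -> W v -> ~ M v -> F v x = F v y.

Definition fprime (W : vset T) : Prop :=
  (exists a b c, W a /\ W b /\ W c /\ a <> b /\ a <> c /\ b <> c) /\
  forall M, fmodule W M -> trivial_module W M.

Lemma F_flip a b c d : F a b = F c d -> F b a = F d c.
Proof. intros H; rewrite (F_sw a b), (F_sw c d); congruence. Qed.

Lemma trivial_of_two (W M : vset T) a b :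
  trivial_module W M -> M a -> M b -> a <> b -> forall x, W x -> M x.
Proof.
  intros [H | [H | [c H]]] Ha Hb ne x Hx.
  - now destruct (H a).
  - now apply H.
  - apply H in Ha, Hb; congruence.
Qed.

(** * Extensions of a prime substructure and their outside graph *)

Section OverPrime.
Context (X : vset T).
Hypothesis primeX : fprime X.

Lemma third a b : exists c, X c /\ c <> a /\ c <> b.
Proof.
  destruct primeX as [(p & q & r & Hp & Hq & Hr & pq & pr & qr) _].
  destruct (classic (p = a \/ p = b)) as [P | P];
    [| exists p; tauto].
  destruct (classic (q = a \/ q = b)) as [Q | Q];
    [| exists q; tauto].
  exists r; split; [easy|]; split; intros ->; destruct P, Q; congruence.
Qed.

(* [cls (Some u)] is the block X(u) and [cls None] the block <X> of the
   partition of the outside of X (Ehrenfeucht-Rozenberg). *)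
Definition cls (o : option T) (x : T) : Prop :=
  match o with
  | Some u => X u /\ forall v, X v -> v <> u -> F v x = F v u
  | None => forall u v, X u -> X v -> F x u = F x v
  end.

(* For [a] in the block [o] and [b] in another block, [dfl o a b] says that the
   relation between [a] and [b] is the one forced by their blocks; this is
   non-adjacency in the outside graph [adj] below. *)
Definition dfl (o : option T) (a b : T) : Prop :=
  match o with
  | Some u => F b a = F b u
  | None => forall u, X u -> F a b = F a u
  end.

Definition same (a b : T) : Prop := exists o, cls o a /\ cls o b.

(** A vertex in two blocks would yield a nontrivial module of the prime [X]: the complement of [u]
    for the blocks X(u) and <X>, the pair [u], [u'] for X(u) and X(u'). *)
Lemma cls_uniq o o' x : cls o x -> cls o' x -> o = o'.
Proof.
  assert (Some_None : forall u, cls (Some u) x -> cls None x -> False).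
  { intros u [Xu Hu] Hn.
    destruct (third u u) as (p & Xp & pu & _).
    destruct (third u p) as (q & Xq & qu & qp).
    assert (T1 : trivial_module X (fun z => X z /\ z <> u)).
    { apply primeX; split; [now intros z []|].
      intros a b v [Xa au] [Xb bu] Xv nv.
      destruct (classic (v = u)) as [-> | vu]; [|tauto].
      pose proof (Hu a Xa au) as Ea. pose proof (Hu b Xb bu) as Eb.
      apply F_flip in Ea, Eb. rewrite <- Ea, <- Eb. now apply Hn. }
    destruct (trivial_of_two T1 (conj Xp pu) (conj Xq qu)
                (fun e => qp (eq_sym e)) _ Xu) as [_ []]; reflexivity. }
  destruct o as [u|], o' as [u'|]; intros H H'; try easy;
    try (now destruct (Some_None u)); try (now destruct (Some_None u')).
  f_equal; apply NNPP; intros ne.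
  destruct H as [Xu Hu], H' as [Xu' Hu'].
  destruct (third u u') as (p & Xp & pu & pu').
  assert (T1 : trivial_module X (set2 u u')).
  { apply primeX; split; [intros z [-> | ->]; easy|].
    assert (D : forall v, X v -> ~ set2 u u' v -> F v u = F v u').
    { intros v Xv nv; rewrite <- Hu, <- Hu'; trivial;
        intros ->; apply nv; unfold set2; tauto. }
    intros a b v [-> | ->] [-> | ->] Xv nv; trivial; [|symmetry]; now apply D. }
  destruct (trivial_of_two T1 (or_introl eq_refl) (or_intror eq_refl) ne _ Xp);
    congruence.
Qed.

Lemma cls_transfer o x y :
  (forall v, X v -> F v x = F v y) -> cls o x -> cls o y.
Proof.
  intros H; destruct o as [u|]; simpl.
  - intros [Xu Hu]; split; [easy|]; intros v Xv vu; rewrite <- H; auto.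
  - intros Hx u v Xu Xv.
    rewrite (F_sw u y), (F_sw v y), <- !H, <- !F_sw; auto.
Qed.

Lemma same_sym a b : same a b -> same b a.
Proof. intros [o []]; now exists o. Qed.

Lemma same_trans a b c : same a b -> same b c -> same a c.
Proof.
  intros [o [Ha Hb]] [o' [Hb' Hc]]; exists o.
  now rewrite (cls_uniq _ _ _ Hb Hb') in *.
Qed.

(** For the blocks X(u) and X(u'), both sides say that [(a, b)] has the colour of [(u, u')]. If
    exactly one block is <X>, its vertex has a constant colour towards [X]. *)
Lemma dfl_sym o o' a b :
  cls o a -> cls o' b -> o <> o' -> dfl o' b a -> dfl o a b.
Proof.
  destruct o as [u|], o' as [u'|]; simpl.
  - intros [Xu Hu] [Xu' Hu'] ne D.
    assert (uu' : u <> u') by congruence.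
    apply F_flip in D; rewrite D, Hu by auto.
    symmetry; apply F_flip, Hu'; auto.
  - intros [Xu _] _ _ D; auto.
  - intros Ha [Xu' _] _ D u Xu; rewrite D; auto.
  - congruence.
Qed.

Lemma dfl_twin_left o a b w :
  cls o a -> cls o b -> dfl o a w -> dfl o b w ->
  (forall v, X v -> F v a = F v b) -> F w a = F w b.
Proof.
  destruct o as [u|]; simpl; intros Ha Hb Da Db E.
  - congruence.
  - destruct (third a a) as (u & Xu & _).
    apply F_flip; rewrite (Da u), (Db u) by easy; now apply F_flip, E.
Qed.

Lemma dfl_twin_right o a b w :
  dfl o w a -> dfl o w b ->
  (forall v, X v -> F v a = F v b) -> cls o w -> F w a = F w b.
Proof.
  destruct o as [u|]; simpl; intros Da Db E Hw.
  - apply F_flip; rewrite Da, Db; apply F_flip, E, Hw.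
  - destruct (third a a) as (u & Xu & _); rewrite (Da u), (Db u); easy.
Qed.

(* The two lemmas below and their converse [nonprime_cases] sort the modules M
   of W by their trace on X, which is empty, a singleton or X.  The last two
   cases merge by taking N to be M \ X, respectively W \ M. *)
Lemma nonprime_of_twins (W N : vset T) m m' :
  subset X W -> subset N (setD W X) -> N m -> N m' -> m <> m' ->
  (forall x y v, N x -> N y -> W v -> ~ N v -> F v x = F v y) -> ~ fprime W.
Proof.
  intros XW NW Nm Nm' ne H [_ P].
  destruct (third m m) as (u & Xu & _).
  assert (M : fmodule W N) by (split; [intros x Hx; now apply NW | exact H]).
  apply (fun h => trivial_of_two (P N M) Nm Nm' ne u h) in XW; trivial.
  now apply NW in XW as [].
Qed.

Lemma nonprime_of_block (W N : vset T) o m :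
  subset X W -> subset N (setD W X) -> N m ->
  (forall x, N x -> cls o x) ->
  (forall x e, N x -> W e -> ~ X e -> ~ N e -> dfl o x e) -> ~ fprime W.
Proof.
  intros XW NW Nm C D [_ P].
  destruct o as [u|]; simpl in *.
  - destruct (C m Nm) as [Xu _].
    destruct (third u u) as (p & Xp & pu & _).
    assert (M : fmodule W (fun z => z = u \/ N z)).
    { split; [intros z [-> | Nz]; [auto | now apply NW]|].
      assert (U : forall x v, (x = u \/ N x) -> W v -> ~ (v = u \/ N v) -> F v x = F v u).
      { intros x v [-> | Nx] Wv nv; [easy|].
        destruct (classic (X v)) as [Xv | nXv].
        - apply (C x Nx); tauto.
        - apply D; tauto. }
      intros x y v Hx Hy Wv nv; rewrite (U x), (U y); auto. }
    assert (mu : u <> m) by (intros ->; now apply NW in Nm as []).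
    destruct (trivial_of_two (P _ M) (or_introl eq_refl) (or_intror Nm) mu p (XW p Xp))
      as [-> | Np]; [easy|]; now apply NW in Np as [].
  - destruct (third m m) as (p & Xp & _).
    destruct (third p p) as (q & Xq & qp & _).
    assert (M : fmodule W (fun z => W z /\ ~ N z)).
    { split; [now intros z []|].
      intros x y v [Wx nx] [Wy ny] Wv nv.
      assert (Nv : N v) by tauto.
      assert (U : forall x, W x -> ~ N x -> F v x = F v p).
      { intros z Wz nz; destruct (classic (X z)).
        - apply C; auto.
        - apply D; auto. }
      rewrite (U x), (U y); auto. }
    assert (XN : forall z, X z -> W z /\ ~ N z)
      by (intros z Xz; split; [auto | intros Nz; now apply NW in Nz as []]).
    assert (Wm : W m) by now apply NW.
    now destruct (trivial_of_two (P _ M) (XN p Xp) (XN q Xq) (fun e => qp (eq_sym e)) m Wm).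
Qed.

Lemma nonprime_cases (W : vset T) :
  subset X W -> ~ fprime W ->
  exists N, subset N (setD W X) /\
    ((exists m m', N m /\ N m' /\ m <> m' /\
       forall x y v, N x -> N y -> W v -> ~ N v -> F v x = F v y) \/
     (exists m o, N m /\ (forall x, N x -> cls o x) /\
       forall x e, N x -> W e -> ~ X e -> ~ N e -> dfl o x e)).
Proof.
  intros XW nP.
  assert (exists M, fmodule W M /\ ~ trivial_module W M) as (M & [MW HM] & nT).
  { apply NNPP; intros no; apply nP; split.
    - destruct primeX as [(p & q & r & Hp & Hq & Hr & ne) _].
      exists p, q, r; auto 6.
    - intros M HM; apply NNPP; intros nt; apply no; now exists M. }
  assert (two : forall a, M a -> exists b, M b /\ b <> a).
  { intros a Ma; apply NNPP; intros no; apply nT; right; right; exists a.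
    intros x; split; [|now intros ->].
    intros Mx; apply NNPP; intros ne; apply no; now exists x. }
  assert (TX : trivial_module X (fun z => X z /\ M z)).
  { apply primeX; split; [now intros z []|].
    intros x y v [Xx Mx] [Xy My] Xv nv; apply HM; auto. }
  destruct TX as [TX | [TX | [u TX]]].
  - exists M; split.
    { intros z Mz; split; [auto | intros Xz; now apply (TX z)]. }
    left.
    assert (exists m, M m) as [m Mm].
    { apply NNPP; intros no; apply nT; left; intros x Mx; apply no; now exists x. }
    destruct (two m Mm) as (m' & Mm' & ne); exists m, m'; auto 6.
  - exists (fun z => W z /\ ~ M z); split.
    { intros z [Wz nz]; split; [easy|]; intros Xz; now apply nz, TX. }
    right.
    assert (exists m, W m /\ ~ M m) as [m Hm].
    { apply NNPP; intros no; apply nT; right; left; intros x; split; [auto|].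
      intros Wx; apply NNPP; intros nx; apply no; now exists x. }
    exists m, None; split; [easy|]; split; simpl.
    + intros x [Wx nx] p q Xp Xq; apply HM; trivial; now apply TX.
    + intros x e [Wx nx] We nXe ne p Xp; apply HM; trivial; [tauto | now apply TX].
  - destruct (proj2 (TX u) eq_refl) as [Xu Mu].
    exists (fun z => M z /\ z <> u); split.
    { intros z [Mz zu]; split; [auto|]; intros Xz; now apply zu, TX. }
    right.
    destruct (two u Mu) as (m & Hm).
    exists m, (Some u); split; [easy|]; split; simpl.
    + intros x [Mx xu]; split; [easy|].
      intros v Xv vu; apply HM; auto. intros Mv; now apply vu, TX.
    + intros x e [Mx xu] We nXe ne; apply HM; auto.
      intros Me; apply ne; split; [easy|]; now intros ->.
Qed.

Definition adj (a b : T) : Prop := a <> b /\ fprime (setU X (set2 a b)).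

Lemma adj_sym a b : adj a b -> adj b a.
Proof.
  intros [ne P]; split; [auto|].
  replace (set2 b a) with (set2 a b); [easy|].
  apply vset_ext; intros x; unfold set2; tauto.
Qed.

Lemma subset_setUl (A : vset T) : subset X (setU X A).
Proof. now left. Qed.

(** If both vertices lie in one block, they form the set N of [nonprime_of_block], with no further
    outside vertex to compare with. *)
Lemma adj_not_same a b : ~ X a -> ~ X b -> adj a b -> ~ same a b.
Proof.
  intros Xa Xb [ne P] [o [Ca Cb]]; revert P.
  apply (@nonprime_of_block _ (set2 a b) o a).
  - apply subset_setUl.
  - intros x Hx; split; [now right|]; destruct Hx; subst; easy.
  - now left.
  - intros x [-> | ->]; easy.
  - intros x e _ [He | He]; easy.
Qed.

Lemma dfl_not_adj o a b :
  ~ X a -> ~ X b -> cls o a -> dfl o a b -> ~ adj a b.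
Proof.
  intros Xa Xb Ca D [ne P]; revert P.
  apply (@nonprime_of_block _ (set1 a) o a).
  - apply subset_setUl.
  - intros x ->; split; [now right; left | easy].
  - easy.
  - now intros x ->.
  - intros x e -> [He | [-> | ->]] H1 H2; try easy. now destruct H2.
Qed.

(** Twins over [X] would share a block, so non-primality must come from a single vertex with the
    forced colour. If that vertex is [b], [dfl_sym] turns the conclusion around. *)
Lemma not_adj_dfl o a b :
  ~ X a -> ~ X b -> a <> b -> cls o a -> ~ cls o b -> ~ adj a b -> dfl o a b.
Proof.
  intros Xa Xb ne Ca Cb nadj.
  destruct (@nonprime_cases (setU X (set2 a b))) as (N & NW & H).
  { apply subset_setUl. }
  { intros P; now apply nadj. }
  assert (Wa : setU X (set2 a b) a) by (right; now left).
  assert (Wb : setU X (set2 a b) b) by (right; now right).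
  assert (Nab : forall x, N x -> x = a \/ x = b).
  { intros x Nx; apply NW in Nx as [[? | ?] ?]; easy. }
  destruct H as [(m & m' & Nm & Nm' & mm & H) | (m & o' & Nm & C & D)].
  - destruct Cb; apply (@cls_transfer o a b); [|easy].
    assert (N a /\ N b) as [Na Nb].
    { destruct (Nab m Nm), (Nab m' Nm'); subst; easy. }
    intros v Xv; apply H; trivial; [now left|].
    intros Nv; now apply NW in Nv as [].
  - destruct (classic (N a)) as [Na | Na].
    + assert (o' = o) as -> by (apply (@cls_uniq o' o a); auto).
      apply D; trivial. intros Nb; now apply Cb, C.
    + assert (N b) as Nb by (destruct (Nab m Nm); subst; easy).
      apply (@dfl_sym o o' a b); auto.
      intros ->; now apply Cb, C.
Qed.

(** This is the upward step of Ehrenfeucht and Rozenberg. Without adjacent pairs, a nonempty block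
    has only forced colours towards the other outside vertices. If all blocks are empty, any two
    outside vertices look alike from [X], so the whole outside is a module. *)
Lemma exists_adj (V : vset T) p q :
  subset X V -> fprime V -> setD V X p -> setD V X q -> p <> q ->
  exists a b, setD V X a /\ setD V X b /\ adj a b.
Proof.
  intros XV PV Hp Hq pq; apply NNPP; intros no.
  assert (nadj : forall a b, setD V X a -> setD V X b -> ~ adj a b).
  { intros a b Ha Hb A; apply no; now exists a, b. }
  destruct (classic (exists o x, setD V X x /\ cls o x)) as [(o & x & Hx & Cx) | nC];
    revert PV.
  - apply (@nonprime_of_block _ (fun z => setD V X z /\ cls o z) o x); trivial.
    + now intros z [].
    + easy.
    + now intros z [].
    + intros z e [Hz Cz] Ve Xe He.
      assert (De : setD V X e) by easy.
      assert (nCe : ~ cls o e) by tauto.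
      apply not_adj_dfl; auto; [apply Hz | congruence].
  - apply (@nonprime_of_twins _ (setD V X) p q); trivial.
    + now intros z.
    + intros a b v Ha Hb Vv Hv.
      assert (Xv : X v) by (apply NNPP; intros h; now apply Hv).
      destruct (classic (a = b)) as [-> | ne]; [easy|].
      destruct (@nonprime_cases (setU X (set2 a b))) as (N & NW & H).
      { apply subset_setUl. }
      { intros P; now apply (nadj a b). }
      assert (Nab : forall x, N x -> x = a \/ x = b).
      { intros x Nx; apply NW in Nx as [[? | ?] ?]; easy. }
      destruct H as [(m & m' & Nm & Nm' & mm & H) | (m & o' & Nm & C & D)].
      * assert (N a /\ N b) as [Na Nb].
        { destruct (Nab m Nm), (Nab m' Nm'); subst; easy. }
        apply H; trivial; [now left|]; intros Nv; now apply NW in Nv as [].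
      * destruct nC; exists o', m; split; [|auto].
        destruct (Nab m Nm); subst; easy.
Qed.

(** A nontrivial module gives a set N. If N consists of twins, its members share a block and have
    the same neighbours. If N is a part of a block with forced colours, its members are isolated. *)
Lemma prime_of_graph (Y : vset T) :
  (forall y, Y y -> ~ X y) ->
  (forall y, Y y -> exists o, cls o y) ->
  (forall y, Y y -> exists z, Y z /\ adj z y) ->
  (forall y y', Y y -> Y y' -> y <> y' -> same y y' ->
     exists z, Y z /\ (adj z y /\ ~ adj z y' \/ adj z y' /\ ~ adj z y)) ->
  fprime (setU X Y).
Proof.
  intros YX YC iso twin; apply NNPP; intros nP.
  destruct (@nonprime_cases _ (@subset_setUl Y) nP) as (N & NW & H).
  assert (NY : forall x, N x -> Y x) by (intros x Nx; apply NW in Nx as [[] ]; easy).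
  destruct H as [(m & m' & Nm & Nm' & mm & H) | (m & o & Nm & C & D)].
  - assert (sX : forall x y v, N x -> N y -> X v -> F v x = F v y).
    { intros x y v Nx Ny Xv; apply H; trivial; [now left|].
      intros Nv; now apply NW in Nv as []. }
    assert (sm : forall x y, N x -> N y -> same x y).
    { intros x y Nx Ny; destruct (YC x (NY x Nx)) as [o Co]; exists o.
      split; [easy|]; apply (@cls_transfer o x y); auto. }
    (* If [z] were not adjacent to [y], the colour between them would be forced; it would then be
       forced for [x] too, which looks the same from [z] and from [X]. *)
    assert (K1 : forall x y z, N x -> N y -> x <> y -> Y z -> adj z x -> adj z y).
    { intros x y z Nx Ny xy Yz A; apply NNPP; intros nA.
      assert (Nz : ~ N z).
      { intros Nz; apply (@adj_not_same z x); auto. }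
      assert (E : F z x = F z y) by (apply H; trivial; now right).
      destruct (YC y (NY y Ny)) as [o Co].
      assert (Cx : cls o x) by (apply (@cls_transfer o y x); auto).
      assert (nCz : ~ cls o z).
      { intros Cz; apply (@adj_not_same z x); auto; now exists o. }
      assert (D : dfl o y z).
      { apply not_adj_dfl; auto; [congruence|]; intros A'; now apply nA, adj_sym. }
      apply (@dfl_not_adj o x z); auto; [|now apply adj_sym].
      destruct o as [u|]; simpl in *; [congruence|].
      intros u Xu; rewrite (F_flip E), (D u Xu); apply F_flip; auto. }
    destruct (twin m m') as (z & Yz & [[A B] | [A B]]); auto; apply B.
    + now apply (K1 m m').
    + apply (K1 m' m); auto.
  - destruct (iso m (NY m Nm)) as (z & Yz & A).
    assert (Nz : ~ N z).
    { intros Nz; apply (@adj_not_same z m); auto; exists o; auto. }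
    apply (@dfl_not_adj o m z); auto; [|now apply adj_sym].
    apply D; auto. now right.
Qed.

(** * The outside graph when no three outside vertices give a prime extension *)

Section Saturated.
Context (Z : vset T).
Hypothesis Z_out : forall a, Z a -> ~ X a.
Hypothesis Z_cls : forall a, Z a -> exists o, cls o a.
Hypothesis no_three : forall a b c, Z a -> Z b -> Z c ->
  a <> b -> a <> c -> b <> c -> ~ fprime (setU X (set3 a b c)).

(** Otherwise [z], [a], [b] lie in pairwise different blocks, so there are no twins to exclude, and
    [prime_of_graph] makes the extension by these three vertices prime. *)
Lemma adj_common_same z a b :
  Z z -> Z a -> Z b -> adj z a -> adj z b -> same a b.
Proof.
  intros Zz Za Zb Aa Ab.
  destruct (classic (a = b)) as [<- | ne].
  { destruct (Z_cls Za) as [o Co]; now exists o. }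
  apply NNPP; intros ns.
  assert (Sa : ~ same z a) by (apply adj_not_same; auto).
  assert (Sb : ~ same z b) by (apply adj_not_same; auto).
  apply (@no_three z a b); trivial; [apply Aa | apply Ab |].
  apply prime_of_graph.
  - intros y [-> | [-> | ->]]; auto.
  - intros y [-> | [-> | ->]]; auto.
  - intros y [-> | [-> | ->]].
    + exists a; split; [unfold set3; tauto | now apply adj_sym].
    + exists z; split; [unfold set3; tauto | easy].
    + exists z; split; [unfold set3; tauto | easy].
  - intros y y' [-> | [-> | ->]] [-> | [-> | ->]] yy S; try easy;
      apply same_sym in S; easy.
Qed.

(** Adjacency of [z] and [x] leaves two options for the set N of [nonprime_cases]: twins [x], [y],
    which forces [z] to be adjacent to [y], or [y] alone, which forbids it. *)
Lemma nonprime_three x y z :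
  Z x -> Z y -> Z z -> x <> y -> adj z x -> same x y -> ~ same z y ->
  (adj z y -> forall v, X v \/ v = z -> F v x = F v y) /\
  (~ adj z y -> forall o, cls o y -> dfl o y x).
Proof.
  intros Zx Zy Zz xy A S nS.
  assert (zx : z <> x) by apply A.
  assert (zy : z <> y).
  { intros ->; apply nS; destruct S as [o []]; now exists o. }
  assert (nSx : ~ same z x) by (apply adj_not_same; auto).
  destruct (@nonprime_cases _ (@subset_setUl (set3 x y z))) as (N & NW & H).
  { apply no_three; auto. }
  assert (Nxyz : forall t, N t -> t = x \/ t = y \/ t = z).
  { intros t Nt; apply NW in Nt as [[? | ?] ?]; easy. }
  assert (Wx : setU X (set3 x y z) x) by (right; unfold set3; tauto).
  assert (Wy : setU X (set3 x y z) y) by (right; unfold set3; tauto).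
  assert (Wz : setU X (set3 x y z) z) by (right; unfold set3; tauto).
  destruct H as [(m & m' & Nm & Nm' & mm & H) | (m & o & Nm & C & D)].
  - assert (SN : forall p q, N p -> N q -> same p q).
    { intros p q Np Nq; apply NW in Np as Hp.
      assert (exists o, cls o p) as [o Co].
      { apply Z_cls; destruct (Nxyz p Np) as [-> | [-> | ->]]; easy. }
      exists o; split; [easy|]; apply (@cls_transfer o p q); [|easy].
      intros v Xv; apply H; trivial; [now left|].
      intros Nv; now apply NW in Nv as []. }
    assert (Nz : ~ N z).
    { intros Nz; destruct (Nxyz m Nm) as [-> | [-> | ->]];
        [apply nSx | apply nS |]; auto.
      destruct (Nxyz m' Nm') as [-> | [-> | ->]]; [apply nSx | apply nS |]; auto. }
    assert (N x /\ N y) as [Nx Ny].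
    { destruct (Nxyz m Nm) as [-> | [-> | ->]], (Nxyz m' Nm') as [-> | [-> | ->]];
        easy. }
    assert (E : forall v, X v \/ v = z -> F v x = F v y).
    { intros v [Xv | ->]; apply H; trivial; [now left|].
      intros Nv; now apply NW in Nv as []. }
    split; [auto|]; intros nA o Co; destruct nA.
    apply NNPP; intros nA.
    assert (D : dfl o y z).
    { apply not_adj_dfl; auto.
      - intros Cz; apply nS; now exists o.
      - intros A'; now apply nA, adj_sym. }
    assert (Cx : cls o x).
    { apply (@cls_transfer o y x); [|easy]; intros v Xv; symmetry; auto. }
    apply (@dfl_not_adj o x z); auto; [|now apply adj_sym].
    destruct o as [u|]; simpl in *.
    + rewrite E; auto.
    + intros u Xu; rewrite (F_flip (E z (or_intror eq_refl))), (D u Xu).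
      symmetry; apply F_flip; auto.
  - assert (Nz : ~ N z).
    { intros Nz.
      assert (Nx : ~ N x) by (intros Nx; apply nSx; exists o; auto).
      apply (@dfl_not_adj o z x); auto. }
    assert (Nx : ~ N x).
    { intros Nx; apply (@dfl_not_adj o x z); auto; now apply adj_sym. }
    assert (Ny : N y) by (destruct (Nxyz m Nm) as [-> | [-> | ->]]; easy).
    split.
    + intros A'; destruct (@dfl_not_adj o y z); auto; now apply adj_sym.
    + intros _ o' Co'; rewrite (cls_uniq o' o y Co' (C y Ny)); auto.
Qed.

Context (V : vset T).
Hypothesis XV : subset X V.
Hypothesis ZV : forall a, Z a <-> V a /\ ~ X a.
Hypothesis primeV : fprime V.

(** Adjacency only concerns different blocks; this lemma controls colours inside one block, for
    vertices that the graph tells apart. *)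
Lemma dfl_of_separated o x y z :
  Z x -> Z y -> Z z -> cls o x -> cls o y -> adj z x -> ~ adj z y -> dfl o y x.
Proof.
  intros Zx Zy Zz Cx Cy A nA.
  apply (@nonprime_three x y z); auto.
  - now intros ->.
  - now exists o.
  - intros S; apply (@adj_not_same z x); auto.
    apply (@same_trans z y x); [easy | now exists o].
Qed.

(** The isolated vertices of one block would have forced colours towards all other outside vertices:
    by non-adjacency across blocks, by [dfl_of_separated] within the block. *)
Lemma no_isolated y : Z y -> exists z, Z z /\ adj z y.
Proof.
  intros Zy; apply NNPP; intros no.
  destruct (Z_cls Zy) as [o Co].
  revert primeV.
  apply (@nonprime_of_block V
    (fun m => Z m /\ cls o m /\ forall z, Z z -> ~ adj z m) o y); trivial.
  - intros m [Zm _]; now apply ZV.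
  - split; [easy|]; split; [easy|]; intros z Zz A; apply no; now exists z.
  - now intros m (_ & Cm & _).
  - intros m e (Zm & Cm & Im) Ve Xe nN.
    assert (Ze : Z e) by now apply ZV.
    destruct (classic (cls o e)) as [Ce | nCe].
    + assert (exists z, Z z /\ adj z e) as (z & Zz & A).
      { apply NNPP; intros nz; apply nN; split; [easy|]; split; [easy|].
        intros z Zz A; apply nz; now exists z. }
      apply (@dfl_of_separated o e m z); auto.
    + apply not_adj_dfl; auto; [congruence|].
      intros A; apply (Im e Ze); now apply adj_sym.
Qed.

(** The vertices of the block that have the same neighbours as [y] would form a module. *)
Lemma no_twins y y' : Z y -> Z y' -> y <> y' -> same y y' ->
  exists z, Z z /\ (adj z y /\ ~ adj z y' \/ adj z y' /\ ~ adj z y).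
Proof.
  intros Zy Zy' ne [o [Co Co']]; apply NNPP; intros no.
  assert (Tw : forall z, Z z -> (adj z y <-> adj z y')).
  { intros z Zz; split; intros A; apply NNPP; intros nA; apply no; exists z; auto. }
  destruct (no_isolated Zy) as (t & Zt & At).
  pose (N := fun m => Z m /\ cls o m /\ forall z, Z z -> (adj z y <-> adj z m)).
  assert (E : forall p q z, N p -> N q -> Z z -> adj z p ->
                forall v, X v \/ v = z -> F v p = F v q).
  { intros p q z (Zp & Cp & Hp) (Zq & Cq & Hq) Zz A.
    destruct (classic (p = q)) as [-> | pq]; [easy|].
    assert (Aq : adj z q) by now apply Hq, Hp.
    apply (@nonprime_three p q z); auto.
    - now exists o.
    - apply adj_not_same; auto. }
  assert (EX : forall p q, N p -> N q -> forall v, X v -> F v p = F v q).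
  { intros p q Np Nq v Xv; apply (E p q t); auto; now apply Np. }
  revert primeV.
  apply (@nonprime_of_twins V N y y'); trivial.
  - intros m [Zm _]; now apply ZV.
  - now split.
  - now split.
  - intros p q v Np Nq Vv nN.
    destruct (classic (X v)) as [Xv | nXv]; [now apply EX|].
    assert (Zv : Z v) by now apply ZV.
    pose proof Np as (Zp & Cp & Hp). pose proof Nq as (Zq & Cq & Hq).
    destruct (classic (adj v y)) as [A | nA].
    { apply (E p q v); auto; now apply Hp. }
    (* Within the block, some [z] separates [v] from [y]; which of the two is adjacent to [z]
       decides the direction of [dfl]. Across blocks non-adjacency applies. *)
    assert (Cases : (dfl o p v /\ dfl o q v) \/ (dfl o v p /\ dfl o v q /\ cls o v)).
    { destruct (classic (cls o v)) as [Cv | nCv].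
      - assert (exists z, Z z /\ ~ (adj z y <-> adj z v)) as (z & Zz & Hz).
        { apply NNPP; intros nz; apply nN; split; [easy|]; split; [easy|].
          intros z Zz; apply NNPP; intros h; apply nz; now exists z. }
        destruct (classic (adj z v)) as [Azv | nAzv].
        + left; split; apply (@dfl_of_separated o v _ z); auto;
            intros h; apply Hz; split; trivial; intros _; [now apply Hp | now apply Hq].
        + assert (adj z y) as Azy by (apply NNPP; tauto).
          right; split; [|split]; trivial; apply (@dfl_of_separated o _ v z); auto;
            [now apply Hp | now apply Hq].
      - left; split; apply not_adj_dfl; auto; try congruence;
          intros h; apply adj_sym in h; apply nA; [now apply Hp | now apply Hq]. }
    destruct Cases as [[Dp Dq] | (Dp & Dq & Cv)].
    + apply (@dfl_twin_left o); auto.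
    + apply (@dfl_twin_right o); auto.
Qed.

End Saturated.
End OverPrime.

(** * Critical structures without prime extensions by five vertices *)

Section Critical.
Context (V X : vset T).
Hypothesis XV : subset X V.
Hypothesis primeV : fprime V.
Hypothesis critV : forall z, setD V X z -> ~ fprime (setD V (set1 z)).

Lemma not_all_but_one W z :
  subset X W -> (forall t, W t <-> V t /\ t <> z) -> setD V X z -> ~ fprime W.
Proof.
  intros XW HW Hz P; apply (critV Hz).
  replace (setD V (set1 z)) with W; [easy|].
  apply vset_ext; intros t; rewrite HW; unfold setD, set1; tauto.
Qed.

(** This is [exists_adj] over [W] in place of [X]; criticality provides a second missing vertex. *)
Lemma grow W p :
  subset X W -> subset W V -> fprime W -> setD V W p ->
  exists a b, setD V W a /\ setD V W b /\ a <> b /\ fprime (setU W (set2 a b)).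
Proof.
  intros XW WV PW Hp.
  assert (exists q, setD V W q /\ p <> q) as (q & Hq & pq).
  { apply NNPP; intros no; apply (@not_all_but_one W p); trivial.
    - intros t; split.
      + intros Wt; split; [auto|]; intros ->; now apply Hp.
      + intros [Vt tp]; apply NNPP; intros nW; apply no; exists t.
        split; [now split | auto].
    - split; [apply Hp|]; intros Xp; now apply Hp, XW. }
  destruct (exists_adj PW WV primeV Hp Hq pq) as (a & b & Ha & Hb & ab & P).
  now exists a, b.
Qed.

(** Growing [W] by a pair would leave exactly one vertex missing, against criticality. *)
Lemma not_all_but_three W a b c :
  subset X W -> subset W V -> (forall t, setD V W t <-> set3 a b c t) ->
  a <> b -> a <> c -> b <> c -> ~ fprime W.
Proof.
  intros XW WV HW ab ac bc PW.
  destruct (@grow W a) as (d & e & Hd & He & de & P); trivial.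
  { apply HW; now left. }
  pose proof (proj1 (HW d) Hd) as Md. pose proof (proj1 (HW e) He) as Me.
  unfold set3 in *.
  assert (exists f, (f = a \/ f = b \/ f = c) /\ f <> d /\ f <> e /\
    (forall t, t = a \/ t = b \/ t = c -> t = d \/ t = e \/ t = f)) as (f & Mf & fd & fe & cov).
  { destruct Md as [-> | [-> | ->]], Me as [-> | [-> | ->]]; try easy;
      (exists a + exists b + exists c);
      (split; [auto|]; split; [assumption + (apply not_eq_sym; assumption)|];
       split; [assumption + (apply not_eq_sym; assumption)|]; intros t Ht; tauto). }
  apply HW in Mf.
  apply (@not_all_but_one (setU W (set2 d e)) f); trivial.
  - intros t Xt; left; auto.
  - intros t; split.
    + intros [Wt | [-> | ->]].
      * split; [auto|]; intros ->; now apply Mf.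
      * split; [apply Hd | auto].
      * split; [apply He | auto].
    + intros [Vt tf]; destruct (classic (W t)) as [Wt | nW]; [now left | right].
      assert (D : setD V W t) by now split.
      apply HW, cov in D; unfold set2; tauto.
  - split; [apply Mf|]; intros Xf; now apply Mf, XW.
Qed.

Hypothesis primeX : fprime X.
Hypothesis no_five : forall a b c d e,
  setD V X a -> setD V X b -> setD V X c -> setD V X d -> setD V X e ->
  a <> b -> a <> c -> a <> d -> a <> e -> b <> c -> b <> d -> b <> e ->
  c <> d -> c <> e -> d <> e ->
  ~ fprime (setU X (fun z => z = a \/ z = b \/ z = c \/ z = d \/ z = e)).

(** Growing by a pair gives a forbidden extension by five vertices. If nothing is left to add, [X]
    itself is prime and misses exactly three vertices. *)
Lemma no_prime_three a b c : setD V X a -> setD V X b -> setD V X c ->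
  a <> b -> a <> c -> b <> c -> ~ fprime (setU X (set3 a b c)).
Proof.
  intros Ha Hb Hc ab ac bc P.
  set (W := setU X (set3 a b c)) in *.
  assert (XW : subset X W) by now left.
  assert (WV : subset W V).
  { intros t [Xt | [-> | [-> | ->]]]; [auto | apply Ha | apply Hb | apply Hc]. }
  destruct (classic (exists p, setD V W p)) as [[p Hp] | none].
  - destruct (@grow W p) as (d & e & Hd & He & de & P5); trivial.
    assert (out : forall t, setD V W t -> setD V X t /\ a <> t /\ b <> t /\ c <> t).
    { intros t [Vt Wt]; unfold W, setU, set3 in Wt.
      split; [split; tauto|]; split; [|split]; intros ->; tauto. }
    apply out in Hd as (Hd & ? & ? & ?), He as (He & ? & ? & ?).
    apply (@no_five a b c d e); trivial.
    replace (setU X _) with (setU W (set2 d e)); [easy|].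
    apply vset_ext; intros t; unfold W, setU, set3, set2; tauto.
  - apply (@not_all_but_three X a b c); trivial; [easy|].
    intros t; split.
    + intros [Vt nX]; apply NNPP; intros nt; apply none; exists t.
      split; [easy|]; now intros [? | ?].
    + intros [-> | [-> | ->]]; easy.
Qed.

Lemma no_prime_one a : setD V X a -> ~ fprime (setU X (set1 a)).
Proof.
  intros Ha P.
  set (W := setU X (set1 a)) in *.
  assert (XW : subset X W) by now left.
  assert (WV : subset W V) by (intros t [Xt | ->]; [auto | apply Ha]).
  destruct (classic (exists p, setD V W p)) as [[p Hp] | none].
  - destruct (@grow W p) as (d & e & Hd & He & de & P3); trivial.
    assert (out : forall t, setD V W t -> setD V X t /\ a <> t).
    { intros t [Vt Wt]; unfold W, setU, set1 in Wt.
      split; [split; tauto|]; intros ->; tauto. }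
    apply out in Hd as [Hd ad], He as [He ae].
    apply (@no_prime_three a d e); trivial.
    replace (setU X _) with (setU W (set2 d e)); [easy|].
    apply vset_ext; intros t; unfold W, setU, set3, set2, set1; tauto.
  - apply (@not_all_but_one X a); trivial; [easy|].
    intros t; split.
    + intros Xt; split; [auto|]; intros ->; now destruct Ha.
    + intros [Vt ta]; apply NNPP; intros nX; apply none; exists t.
      split; [easy|]; now intros [? | ?].
Qed.

Local Notation Z := (setD V X).

Lemma outside_cls a : Z a -> exists o, cls X o a.
Proof.
  intros Za.
  destruct (nonprime_cases primeX (@subset_setUl X (set1 a)) (no_prime_one Za))
    as (N & NW & H).
  assert (Na : forall t, N t -> t = a).
  { intros t Nt; apply NW in Nt as [[? | ?] ?]; easy. }
  destruct H as [(m & m' & Nm & Nm' & mm & _) | (m & o & Nm & C & _)].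
  - destruct mm; now rewrite (Na m), (Na m').
  - exists o; rewrite <- (Na m); auto.
Qed.

Lemma outside_not_X a : Z a -> ~ X a.
Proof. now intros []. Qed.

Lemma outside_common_same z a b :
  Z z -> Z a -> Z b -> adj X z a -> adj X z b -> same X a b.
Proof.
  apply (adj_common_same primeX Z outside_not_X outside_cls no_prime_three).
Qed.

Lemma prime_of_reduced Y :
  subset Y Z -> reduced (adj X) (same X) Y -> fprime (setU X Y).
Proof.
  intros YZ [iso twin]; apply prime_of_graph; trivial.
  - intros y Yy; now apply YZ.
  - intros y Yy; now apply outside_cls, YZ.
Qed.

Lemma outside_reduced : reduced (adj X) (same X) Z.
Proof.
  assert (ZV : forall a, Z a <-> V a /\ ~ X a) by easy.
  split.
  - intros y; apply (no_isolated primeX Z outside_not_X outside_cls no_prime_three XV ZV primeV).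
  - intros y y'; apply (no_twins primeX Z outside_not_X outside_cls no_prime_three XV ZV primeV).
Qed.

(** Common neighbours put [a], [c], [e] in one block and [b], [d] in another, so the path has no
    chords at all. It is then reduced, and [X] with these five vertices would be prime. *)
Lemma outside_no_P5 a b c d e : Z a -> Z b -> Z c -> Z d -> Z e ->
  adj X a b -> adj X b c -> adj X c d -> adj X d e ->
  ~ adj X a d -> ~ adj X b e -> False.
Proof.
  intros Za Zb Zc Zd Ze ab bc cd de nad nbe.
  pose proof (adj_sym ab) as ba. pose proof (adj_sym bc) as cb.
  pose proof (adj_sym cd) as dc. pose proof (adj_sym de) as ed.
  assert (nda : ~ adj X d a) by (intros h; now apply nad, adj_sym).
  assert (neb : ~ adj X e b) by (intros h; now apply nbe, adj_sym).
  assert (ac : same X a c) by now apply (@outside_common_same b).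
  assert (bd : same X b d) by now apply (@outside_common_same c).
  assert (ce : same X c e) by now apply (@outside_common_same d).
  assert (tr : forall p q r, same X p q -> same X q r -> same X p r)
    by (intros p q r; now apply same_trans).
  assert (sy : forall p q, same X p q -> same X q p)
    by (intros p q; apply same_sym).
  assert (ae : same X a e) by now apply (tr a c e).
  assert (nab : ~ same X a b).
  { apply adj_not_same; trivial; now apply outside_not_X. }
  assert (cross : forall p q, same X a p -> same X b q -> ~ same X p q).
  { intros p q ap bq pq; apply nab, (tr a p b); trivial.
    apply (tr p q b); auto. }
  assert (aa : same X a a) by (apply (tr a c a); auto).
  assert (bb : same X b b) by (apply (tr b d b); auto).
  assert (neq : forall p q, same X a p -> same X b q -> p <> q).
  { intros p q ap bq ->; apply (cross q q); trivial; apply (tr q a q); auto. }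
  assert (a <> c) by congruence. assert (a <> e) by congruence.
  assert (c <> e) by congruence. assert (b <> d) by congruence.
  apply (@no_five a b c d e); trivial; try (now apply neq);
    try (now apply not_eq_sym, neq).
  apply prime_of_reduced.
  { intros t [-> | [-> | [-> | [-> | ->]]]]; easy. }
  split.
  { intros y [-> | [-> | [-> | [-> | ->]]]];
      [exists b | exists a | exists b | exists c | exists d]; auto 6. }
  intros y y' Hy Hy' ne S.
  assert (side : forall t, t = a \/ t = b \/ t = c \/ t = d \/ t = e ->
    (t = a \/ t = c \/ t = e) /\ same X a t \/ (t = b \/ t = d) /\ same X b t).
  { intros t [-> | [-> | [-> | [-> | ->]]]]; auto 6. }
  assert (out : (y = a \/ y = c \/ y = e) /\ (y' = a \/ y' = c \/ y' = e) \/
                (y = b \/ y = d) /\ (y' = b \/ y' = d)).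
  { destruct (side y Hy) as [[? A] | [? A]], (side y' Hy') as [[? B] | [? B]];
      auto; exfalso; [apply (cross y y') | apply (cross y' y)]; auto. }
  clear - out ne ab ba cb dc bc cd de ed nad nda nbe neb.
  destruct out as [[[-> | [-> | ->]] [-> | [-> | ->]]] | [[-> | ->] [-> | ->]]];
    try (destruct ne; reflexivity);
    (* Here [d] separates [a] from [c], [b] separates [e] from [a] and from [c], and [a] separates
       [b] from [d]. *)
    (exists a + exists b + exists d);
    (split; [auto 6 | (left; split; assumption) + (right; split; assumption)]).
Qed.

Lemma setU_setD A : subset A Z -> setU X (setD Z A) = setD V A.
Proof.
  intros AZ; apply vset_ext; intros t; unfold setU, setD; split.
  - intros [Xt | [[Vt nX] nA]]; [|easy]; split; [auto|].
    intros At; now destruct (AZ t At).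
  - intros [Vt nA]; destruct (classic (X t)); tauto.
Qed.

Lemma critical_remove_pair x : Z x ->
  exists y, Z y /\ y <> x /\ fprime (setD V (set2 x y)) /\
    forall z, setD Z (set2 x y) z -> ~ fprime (setD (setD V (set2 x y)) (set1 z)).
Proof.
  intros Zx.
  destruct (@reduced_remove_pair T Z (adj X) (same X)) with (x := x)
    as (y & Zy & yx & R); trivial.
  - apply adj_sym.
  - intros a b Za Zb; apply adj_not_same; trivial; now apply outside_not_X.
  - apply same_sym.
  - exact outside_common_same.
  - exact outside_no_P5.
  - exact outside_reduced.
  - intros R; apply (critV Zx); rewrite <- setU_setD by now intros t ->.
    apply prime_of_reduced; [now intros t []|easy].
  - exists y; split; [easy|]; split; [easy|]; split.
    { rewrite <- setU_setD by (intros t [-> | ->]; easy).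
      apply prime_of_reduced; [now intros t []|easy]. }
    intros z [Zz nz].
    (* Deleting [z] as well leaves a set that misses exactly three vertices. *)
    apply (@not_all_but_three _ x y z).
    + intros t Xt; split; [split; [auto|]|].
      * intros [-> | ->]; [now apply Zx | now apply Zy].
      * intros ->; now apply Zz.
    + now intros t [[] ].
    + unfold setD, set2, set1, set3; intros t; split.
      * intros [Vt nW]; apply NNPP; tauto.
      * intros [-> | [-> | ->]]; (split; [apply Zx || apply Zy || apply Zz | tauto]).
    + auto.
    + intros ->; apply nz; now left.
    + intros ->; apply nz; now right.
Qed.

End Critical.
End Coloring.

(** * From equivalence of ordered pairs to colours *)

Section Transfer.
Context (T : Type) (V : vset T) (E : T * T -> T * T -> Prop).
Hypothesis EV : two_structure V E.

(* Replacing a pair by its equivalence class turns E into equality of colors. *)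
Definition pair_class (p : T * T) : T * T -> Prop := fun q => dpair V q /\ E p q.
(** Recording both orientations makes reversal a swap of components, as [F_sw] demands, and lets one
    equality express both conditions of [is_module]. *)
Definition color (a b : T) := (pair_class (a, b), pair_class (b, a)).

Lemma pair_class_eq p q :
  dpair V p -> dpair V q -> (E p q <-> pair_class p = pair_class q).
Proof.
  destruct EV as (rf & sy & tr); intros Vp Vq; split.
  - intros H; apply vset_ext; intros r; split; intros [Vr Hr]; split; trivial.
    + apply (tr q p r); auto.
    + apply (tr p q r); auto.
  - intros H; assert (pair_class p q) by (rewrite H; split; auto).
    now destruct H0.
Qed.

Lemma prime2_fprime (W : vset T) :
  subset W V -> (prime2 E W <-> fprime color W).
Proof.
  intros WV.
  assert (M : forall M, is_module E W M <-> fmodule color W M).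
  { assert (D : forall M x v, subset M W -> M x -> W v -> ~ M v ->
              dpair V (x, v) /\ dpair V (v, x)).
    { intros M x v MW Mx Wv nv.
      assert (x <> v) by congruence.
      split; split; simpl; auto. }
    intros M; split; intros [MW H]; split; trivial; intros x y v Mx My Wv nv;
      destruct (D M x v MW Mx Wv nv), (D M y v MW My Wv nv).
    - unfold color; f_equal; apply pair_class_eq; trivial; now apply H.
    - pose proof (H x y v Mx My Wv nv) as C; injection C as C1 C2.
      split; now apply pair_class_eq. }
  split; intros [H P]; split; trivial; intros N HN; now apply P, M.
Qed.

End Transfer.

Theorem theorem1p25 (T : Type) (V : vset T) (E : T * T -> T * T -> Prop)
  (X : vset T) :
  two_structure V E ->
  subset X V ->
  (exists v, V v /\ ~ X v) ->
  prime2 E X ->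
  (* (S5): no 5-element Y included in V \ X with sigma[X u Y] prime *)
  ~ (exists y1 y2 y3 y4 y5 : T,
       setD V X y1 /\ setD V X y2 /\ setD V X y3 /\ setD V X y4 /\ setD V X y5 /\
       y1 <> y2 /\ y1 <> y3 /\ y1 <> y4 /\ y1 <> y5 /\ y2 <> y3 /\ y2 <> y4 /\
       y2 <> y5 /\ y3 <> y4 /\ y3 <> y5 /\ y4 <> y5 /\
       prime2 E (setU X (fun z => z = y1 \/ z = y2 \/ z = y3 \/ z = y4 \/ z = y5))) ->
  critical E V (setD V X) ->
  forall x, setD V X x ->
    exists y, setD V X y /\ y <> x /\
      critical E (setD V (set2 x y)) (setD (setD V X) (set2 x y)).
Proof.
  intros EV XV _ PX S5 [PV crit] x Hx.
  pose proof (@prime2_fprime T V E EV) as tr.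
  destruct (@critical_remove_pair T _ (color V E)
    (fun p => (snd p, fst p)) (fun a b => eq_refl) V X) with (x := x)
    as (y & Hy & yx & P & C); trivial.
  - now apply tr.
  - intros z Hz P; apply (crit z Hz), tr; [now intros t []|easy].
  - now apply tr.
  - intros a b c d e Ha Hb Hc Hd He; intros; intros P.
    apply S5; exists a, b, c, d, e.
    (* Five memberships and ten inequalities precede primality. *)
    do 15 (split; [easy|]); apply tr; [|easy].
    intros t [Xt | [-> | [-> | [-> | [-> | ->]]]]]; auto;
      [apply Ha | apply Hb | apply Hc | apply Hd | apply He].
  - exists y; split; [easy|]; split; [easy|]; split.
    + apply tr; [now intros t []|easy].
    + intros z Hz Pz; apply (C z Hz), tr; [now intros t [[] ]|easy].
Qed.
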